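(* If $\mathcal{P}$ is a Frobenius, toral poset, then the spectrum of $\mathfrak{g}_A(\mathcal{P})$ is binary, i.e. consists of an equal number of $0$'s and $1$'s.
   Context: **Posets and Lie poset algebras.** $\mathbf{k}$ is a field of characteristic zero. All posets are finite. For a poset $(\mathcal{P},\preceq)$: $Rel(\mathcal{P})$ is the set of strict relations of $\mathcal{P}$, viewed as ordered pairs $(p,q)$ with $p\preceq q$, $p\ne q$; $Ext(\mathcal{P})$ is the set of all minimal and maximal elements of $\mathcal{P}$. The comparability graph of $\mathcal{P}$ has vertex set $\mathcal{P}$ and an edge for every element of $Rel(\mathcal{P})$. A subset $I\subset\mathcal{P}$ is an (order) ideal if $x\in I$, $y\preceq x$ imply $y\in I$; a subset $U\subset \mathcal{P}$ is a filter if $x\in U$, $x\preceq y$ imply $y\in U$. $\Sigma(\mathcal{P})$ is the simplicial complex whose $n$-dimensional faces are the chains of cardinality $n+1$ in $\mathcal{P}$ (the order complex). $\mathfrak{g}(\mathcal{P})$ is the Lie algebra with $\mathbf{k}$-basis $\{E_{p,q}: p\preceq q\}$, with bracket $[a,b]=ab-ba$ for the associative product $E_{p,q}E_{r,s}=E_{p,s}$ if $q=r$ and $0$ otherwise; $\mathfrak{g}_A(\mathcal{P})$ is the Lie subalgebra of elements $\sum c_{p,q}E_{p,q}$ with trace $\sum_p c_{p,p}=0$. **Index, Frobenius, spectrum.** For a Lie algebra $\mathfrak{g}$ and $F\in\mathfrak{g}^*$, $B_F(x,y)=F([x,y])$, and $\operatorname{ind}\mathfrak{g}=\min_{F\in\mathfrak{g}^*}\dim\ker(B_F)$.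 $\mathfrak{g}$ is Frobenius if $\operatorname{ind}\mathfrak{g}=0$; $F$ is then a Frobenius functional if $\dim\ker(B_F)=0$. The principal element $\widehat{F}\in\mathfrak{g}$ of a Frobenius functional $F$ is the unique element with $B_F(\widehat F,-)=F$. The spectrum of a Frobenius Lie algebra $\mathfrak{g}$ is the multiset of eigenvalues of $ad(\widehat F)=[\widehat F,-]:\mathfrak{g}\to\mathfrak{g}$ (independent of the choice of $F$); it is binary if it consists of an equal number of $0$'s and $1$'s. A poset $\mathcal{P}$ is Frobenius if $\mathfrak{g}_A(\mathcal{P})$ is Frobenius. **Functionals.** $E^*_{p,q}$ is the functional sending $B=\sum b_{p,q}E_{p,q}$ to $b_{p,q}$. All functionals considered have the form $F=F_S=\sum_{(p,q)\in S}E^*_{p,q}$ with $S\subset Rel(\mathcal{P})$; the same formula defines $F$ on $\mathfrak{g}(\mathcal{P})$. $\Gamma_F=\Gamma_F(\mathcal{P})$ is the directed subgraph of the comparability graph with a directed edge from $p$ to $q$ for each $(p,q)\in S$. $F$ is small if $\Gamma_F$ is a spanning subtree of the comparability graph. For small $F$: $U_F(\mathcal{P})$ is the set of sinks of $\Gamma_F$, $D_F(\mathcal{P})$ the set of sources, $B_F(\mathcal{P})$ the set of vertices that are neither. $\mathfrak{g}(\mathcal{P})\cap\ker(F)$ denotes the set of $B\in\mathfrak{g}(\mathcal{P})$ with $F([x,B])=0$ for all $x\in\mathfrak{g}(\mathcal{P})$. **Toral-pairs.** For a Frobenius poset $\mathcal{P}$ and a Frobenius functional $F\in(\mathfrak{g}_A(\mathcal{P}))^*$,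 $(\mathcal{P},F)$ is a toral-pair if: (P1) $|Ext(\mathcal{P})|=2$ or $3$; (P2) $\mathfrak{g}_A(\mathcal{P})$ has a binary spectrum; (P3) $\Sigma(\mathcal{P})$ is contractible; (F1) $F$ is small; (F2) $U_F(\mathcal{P})$ is a filter, $D_F(\mathcal{P})$ is an ideal, and $B_F(\mathcal{P})=\emptyset$; (F3) $\Gamma_F$ contains all edges of the comparability graph between elements of $Ext(\mathcal{P})$; (F4) every $B\in\mathfrak{g}(\mathcal{P})\cap\ker(F)$ satisfies $E^*_{p,p}(B)=E^*_{q,q}(B)$ for all $p,q\in\mathcal{P}$ and $E^*_{p,q}(B)=0$ for all $p\preceq q$, $p\neq q$. **Construction rules.** Let $(\mathcal{S},F)$ be a toral-pair and $\mathcal{Q}$ a poset. One combines $\mathcal{S}$ and $\mathcal{Q}$ by identifying minimal (resp. maximal) elements of $\mathcal{S}$ with minimal (resp. maximal) elements of $\mathcal{Q}$ (the result is the union of the two posets glued along the identified elements, with the union of the two order relations). If $|Ext(\mathcal{S})|=2$ write $Ext(\mathcal{S})=\{a,b\}$ with $a\preceq b$ or $b\preceq a$; if $|Ext(\mathcal{S})|=3$ write $Ext(\mathcal{S})=\{a,b,c\}$ with either $a\preceq b,c$ or $b,c\preceq a$. Let $x,y,z\in Ext(\mathcal{Q})$; if $a$, $b$, $c$ are identified with elements of $\mathcal{Q}$, these are $x$, $y$, $z$ respectively. Write $\sim_{\mathcal{Q}}$ for ''comparable in $\mathcal{Q}$'' and $\nsim_{\mathcal{Q}}$ for ''not comparable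 in $\mathcal{Q}$''. Rules (only the listed elements are identified): if $|Ext(\mathcal{S})|=2$ or $3$: $A_1$: identify $b$ with $y$; $C$: identify $a$ with $x$; $E_1$: identify $a,b$ with $x,y$ where $x\nsim_{\mathcal{Q}}y$. If $|Ext(\mathcal{S})|=3$: $A_2$: identify $c$ with $z$; $B$: identify $b,c$ with $y,z$; $D_1$: identify $a,b$ with $x,y$ where $x\sim_{\mathcal{Q}}y$; $D_2$: identify $a,c$ with $x,z$ where $x\sim_{\mathcal{Q}}z$; $E_2$: identify $a,c$ with $x,z$ where $x\nsim_{\mathcal{Q}}z$; $F$: identify $a,b,c$ with $x,y,z$ where $x\sim_{\mathcal{Q}}y$, $x\sim_{\mathcal{Q}}z$; $G_1$: identify $a,b,c$ with $x,y,z$ where $x\sim_{\mathcal{Q}}y$, $x\nsim_{\mathcal{Q}}z$; $G_2$: identify $a,b,c$ with $x,y,z$ where $x\nsim_{\mathcal{Q}}y$, $x\sim_{\mathcal{Q}}z$; $H$: identify $a,b,c$ with $x,y,z$ where $x\nsim_{\mathcal{Q}}y$, $x\nsim_{\mathcal{Q}}z$. **Toral posets.** A poset $\mathcal{P}$ is toral if there are toral-pairs $\{(\mathcal{S}_i,F_{\mathcal{S}_i})\}_{i=1}^n$ and posets $\mathcal{S}_1=\mathcal{Q}_1\subset\mathcal{Q}_2\subset\cdots\subset\mathcal{Q}_n=\mathcal{P}$ (a construction sequence for $\mathcal{P}$) such that, for $i=2,\dots,n$, $\mathcal{Q}_i$ is formed from $\mathcal{Q}_{i-1}$ and $\mathcal{S}_i$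 by applying a rule from $\{A_1,A_2,B,C,D_1,D_2,E_1,E_2,F,G_1,G_2,H\}$. *)

(* Defs.v *)
From HB Require Import structures.
From mathcomp Require Import all_boot all_order all_algebra.
From mathcomp Require Import all_classical all_reals all_analysis.
Import numFieldNormedType.Exports.

Set Implicit Arguments.
Unset Strict Implicit.
Unset Printing Implicit Defensive.

Import Order.TTheory GRing.Theory Num.Theory.
Local Open Scope ring_scope.

Record lieAlgebra (k : fieldType) := LieAlgebra {
  lie_car :> vectType k;
  lie_br : lie_car -> lie_car -> lie_car;
  lie_br_linearl : forall y, linear (fun x => lie_br x y);
  lie_br_linearr : forall x, linear (lie_br x);
  lie_br_alt : forall x, lie_br x x = 0;
  lie_jacobi : forall x y z,
    lie_br x (lie_br y z) + lie_br y (lie_br z x) + lie_br z (lie_br x y) = 0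
}.

Section LieTheory.
Variables (k : fieldType) (L : lieAlgebra k).

Definition ad (x : L) : 'End(L) := linfun (lie_br x).

Lemma adE x y : ad x y = lie_br x y.
Proof.
pose br_lin := GRing.isLinear.Build k L L *:%R (lie_br x) (lie_br_linearr x).
pose f : {linear L -> L} := HB.pack (lie_br x) br_lin.
exact: (lfunE f).
Qed.

Definition form_ker (F : 'Hom(L, k^o)) : {vspace L} :=
  lker (linfun (fun x : L => (F \o ad x)%VF)).

Lemma mem_form_kerP (F : 'Hom(L, k^o)) (x : L) :
  reflect (forall y, F (lie_br x y) = 0) (x \in form_ker F).
Proof.
have lin : linear (fun z : L => (F \o ad z)%VF).
  move=> a u v; apply/lfunP => y.
  by rewrite add_lfunE scale_lfunE !comp_lfunE !adE lie_br_linearl linearP.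
pose f_lin := GRing.isLinear.Build k L _ *:%R (fun z : L => (F \o ad z)%VF) lin.
pose f : {linear L -> 'Hom(L, k^o)} :=
  HB.pack (fun z : L => (F \o ad z)%VF) f_lin.
rewrite /form_ker memv_ker (lfunE f) /=.
apply: (iffP eqP) => [E y | E].
  by rewrite -adE -comp_lfunE E zero_lfunE.
by apply/lfunP => y; rewrite comp_lfunE adE E zero_lfunE.
Qed.

Lemma lie_index_ex :
  exists n, `[< exists F : 'Hom(L, k^o), \dim (form_ker F) = n >].
Proof. by exists (\dim (form_ker 0)); apply/asboolP; exists 0. Qed.

Definition lie_index : nat := ex_minn lie_index_ex.

Definition frobenius : Prop := lie_index = 0%N.

Definition frobenius_functional (F : 'Hom(L, k^o)) : Prop :=
  \dim (form_ker F) = 0%N.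

Definition principal_element (F : 'Hom(L, k^o)) (x : L) : Prop :=
  forall y, F (lie_br x y) = F y.

(* Eigenvalues are counted with algebraic multiplicity; [s] lists all of them
   because its product formula is the whole characteristic polynomial.  Nothing
   is assumed about independence of the functional: [s] has to be the spectrum
   for every Frobenius functional. *)
Definition has_spectrum (s : seq k) : Prop :=
  frobenius /\
  forall (F : 'Hom(L, k^o)) (x : L),
    frobenius_functional F -> principal_element F x ->
    char_poly (passmx.mxof (vbasis {:L}) (vbasis {:L}) (ad x))
      = \prod_(a <- s) ('X - a%:P).

Definition binary_spectrum : Prop :=
  exists m : nat, has_spectrum (nseq m 0 ++ nseq m 1).

End LieTheory.

Section MatrixLie.
Variables (k : fieldType) (n : nat).
Implicit Types (A B : 'M[k]_n) (V : {vspace 'M[k]_n}).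

Definition commutator A B : 'M[k]_n := A *m B - B *m A.

Definition bracket_closed V : Prop :=
  forall A B, A \in V -> B \in V -> commutator A B \in V.

Variables (V : {vspace 'M[k]_n}) (Vbr : bracket_closed V).

Definition sub_br (x y : subvs_of V) : subvs_of V :=
  Subvs (Vbr (subvsP x) (subvsP y)).

Fact sub_br_linearl y : linear (fun x => sub_br x y).
Proof.
move=> a u v; apply/val_inj; rewrite [RHS]linearP /=.
rewrite /commutator mulmxDl mulmxDr -!scalemxAl -!scalemxAr.
by rewrite scalerBr opprD addrACA.
Qed.

Fact sub_br_linearr x : linear (sub_br x).
Proof.
move=> a u v; apply/val_inj; rewrite [RHS]linearP /=.
rewrite /commutator mulmxDl mulmxDr -!scalemxAl -!scalemxAr.
by rewrite scalerBr opprD addrACA.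
Qed.

Fact sub_br_alt x : sub_br x x = 0.
Proof. by apply/val_inj; rewrite /= /commutator subrr. Qed.

Fact sub_jacobi x y z :
  sub_br x (sub_br y z) + sub_br y (sub_br z x) + sub_br z (sub_br x y) = 0.
Proof.
apply/val_inj; rewrite !(linearD vsval) linear0 /= /commutator.
move: (vsval x) (vsval y) (vsval z) => A B C.
rewrite !mulmxBr !mulmxBl !mulmxA !opprB.
set a := A *m B *m C; set b := A *m C *m B; set c := B *m C *m A.
set d := C *m B *m A; set e := B *m A *m C; set f := C *m A *m B.
rewrite [c - e + _]addrC [X in X + _]addrACA !subrKA.
by rewrite addrACA !subrKA subrr.
Qed.

Definition matrix_lie : lieAlgebra k :=
  LieAlgebra sub_br_linearl sub_br_linearr sub_br_alt sub_jacobi.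

End MatrixLie.

Section PosetLie.
Variables (k : fieldType) (d : Order.disp_t) (P : finPOrderType d).
Local Notation n := #|{: P}|.

Definition Emx (p q : P) : 'M[k]_n := delta_mx (enum_rank p) (enum_rank q).

Definition Estar (p q : P) : 'Hom('M[k]_n, k^o) :=
  linfun (fun B : 'M[k]_n => B (enum_rank p) (enum_rank q) : k^o).

Lemma EstarE p q B : Estar p q B = B (enum_rank p) (enum_rank q).
Proof.
pose f (C : 'M[k]_n) : k^o := C (enum_rank p) (enum_rank q).
have lin : linear f by move=> a u v; rewrite /f !mxE.
pose f_lin := GRing.isLinear.Build k _ k^o *:%R f lin.
pose g : {linear 'M[k]_n -> k^o} := HB.pack f f_lin.
exact: (lfunE g).
Qed.

Definition g_space : {vspace 'M[k]_n} :=
  <<[seq Emx e.1 e.2 | e <- enum [set e : P * P | (e.1 <= e.2)%O]%SET]>>%VS.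

Definition gA_space : {vspace 'M[k]_n} :=
  (g_space :&: lker (linfun (fun B : 'M[k]_n => \tr B : k^o)))%VS.

Lemma mem_g_spaceP B :
  reflect (forall p q : P, ~~ (p <= q)%O -> Estar p q B = 0) (B \in g_space).
Proof.
apply: (iffP idP) => [gB p q npq | B0].
  set K := lker (Estar p q).
  suff /subvP/(_ B gB) : (g_space <= K)%VS by rewrite memv_ker => /eqP.
  apply/span_subvP => _ /mapP[[r s] + ->]; rewrite mem_enum inE => rs.
  rewrite memv_ker EstarE mxE /= !(inj_eq enum_rank_inj).
  case: (p =P _) => //= pr; case: (q =P _) => //= qs.
  by rewrite pr qs rs in npq.
rewrite (matrix_sum_delta B); apply: memv_suml => i _; apply: memv_suml => j _.
have [le|/B0] := boolP (enum_val i <= enum_val j)%O; last first.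
  by rewrite EstarE !enum_valK => ->; rewrite scale0r mem0v.
apply: memvZ; apply: memv_span; apply/mapP; exists (enum_val i, enum_val j).
  by rewrite mem_enum inE.
by rewrite /Emx !enum_valK.
Qed.

Lemma mem_gA_space B : (B \in gA_space) = (B \in g_space) && (\tr B == 0).
Proof.
have lin : linear (fun C : 'M[k]_n => \tr C : k^o).
  by move=> a u v; rewrite linearP.
pose f_lin := GRing.isLinear.Build k _ k^o *:%R _ lin.
pose g : {linear 'M[k]_n -> k^o} := HB.pack (fun C : 'M[k]_n => \tr C : k^o) f_lin.
by rewrite memv_cap memv_ker (lfunE g).
Qed.

Lemma g_mulmx A B : A \in g_space -> B \in g_space -> A *m B \in g_space.
Proof.
move=> /mem_g_spaceP gA /mem_g_spaceP gB; apply/mem_g_spaceP => p q npq.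
rewrite EstarE mxE big1 // => i _.
have [pi|/gA] := boolP (p <= enum_val i)%O; last first.
  by rewrite EstarE enum_valK => ->; rewrite mul0r.
have [iq|/gB] := boolP (enum_val i <= q)%O; last first.
  by rewrite EstarE enum_valK => ->; rewrite mulr0.
by rewrite (le_trans pi iq) in npq.
Qed.

Fact g_bracket_closed : bracket_closed g_space.
Proof. by move=> A B gA gB; rewrite rpredB // g_mulmx. Qed.

Fact gA_bracket_closed : bracket_closed gA_space.
Proof.
move=> A B; rewrite !mem_gA_space => /andP[gA _] /andP[gB _].
by rewrite g_bracket_closed //= /commutator linearB /= mxtrace_mulC subrr.
Qed.

Definition g_lie : lieAlgebra k := matrix_lie g_bracket_closed.
Definition gA_lie : lieAlgebra k := matrix_lie gA_bracket_closed.

Definition functional (S : {set P * P}) : 'Hom('M[k]_n, k^o) :=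
  \sum_(e in S) Estar e.1 e.2.

Definition functional_g (S : {set P * P}) : 'Hom(g_lie, k^o) :=
  (functional S \o linfun (vsval (U := g_space)))%VF.

Definition functional_gA (S : {set P * P}) : 'Hom(gA_lie, k^o) :=
  (functional S \o linfun (vsval (U := gA_space)))%VF.

End PosetLie.

Arguments g_lie k {d} P.
Arguments gA_lie k {d} P.

Section PosetCombinatorics.
Variables (d : Order.disp_t) (P : finPOrderType d).
Local Open Scope set_scope.

Definition Rel : {set P * P} := [set e | (e.1 < e.2)%O].

Definition minimal (p : P) : bool := [forall q : P, (q <= p)%O ==> (q == p)].
Definition maximal (p : P) : bool := [forall q : P, (p <= q)%O ==> (q == p)].

Definition Ext : {set P} := [set p | minimal p || maximal p].

Definition order_ideal (I : {set P}) : Prop :=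
  forall x y : P, x \in I -> (y <= x)%O -> y \in I.

Definition order_filter (U : {set P}) : Prop :=
  forall x y : P, x \in U -> (x <= y)%O -> y \in U.

Definition order_complex : {set {set P}} :=
  [set C : {set P} | (C != finset.set0) &&
     [forall p in C, forall q in C, (p >=< q)%O]].

Definition sinks (S : {set P * P}) : {set P} :=
  [set p | [forall q, (p, q) \notin S]].
Definition sources (S : {set P * P}) : {set P} :=
  [set p | [forall q, (q, p) \notin S]].
Definition inner_vertices (S : {set P * P}) : {set P} :=
  [set p | (p \notin sinks S) && (p \notin sources S)].

Definition adjacent (S : {set P * P}) : rel P :=
  fun p q => ((p, q) \in S) || ((q, p) \in S).

(* A closed walk p, q, p along a single edge satisfies [ucycle], whence the
   bound 2. *)
Definition acyclic (e : rel P) : Prop :=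
  forall c : seq P, ucycle e c -> (size c <= 2)%N.

Definition small (S : {set P * P}) : Prop :=
  [/\ S \subset Rel,
      forall p q : P, connect (adjacent S) p q
    & acyclic (adjacent S)].

End PosetCombinatorics.

Arguments Rel {d} P.
Arguments Ext {d} P.
Arguments order_complex {d} P.

Section Topology.
Local Open Scope classical_set_scope.

Definition contractible (R : realType) (T : topologicalType) (A : set T) : Prop :=
  exists2 x0 : T, A x0 &
  exists H : R * T -> T,
    [/\ {within `[0, 1] `*` A, continuous H},
        forall t x, `[0, 1] t -> A x -> A (H (t, x)),
        forall x, A x -> H (0, x) = x
      & forall x, A x -> H (1, x) = x0].

Definition nonzero_set (R : realType) (V : finType) (w : 'rV[R]_#|{: V}|) : {set V} :=
  [set v | w 0 (enum_rank v) != 0]%SET.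

(* Barycentric coordinates in the space with one axis per vertex; R is any model
   of the real line, unrelated to the ground field k of the Lie algebras. *)
Definition realization (R : realType) (V : finType) (K : {set {set V}}) :
    set 'rV[R]_#|{: V}| :=
  [set w : 'rV[R]_#|{: V}| |
    [/\ forall i, 0 <= w 0 i, \sum_i w 0 i = 1 & nonzero_set w \in K]].

End Topology.

Arguments contractible R {T} A.
Arguments realization R {V} K.

Record toral_pair (R : realType) (k : fieldType) (d : Order.disp_t)
    (P : finPOrderType d) (S : {set P * P}) : Prop := ToralPair {
  tp_frobenius : frobenius (gA_lie k P);
  tp_functional : frobenius_functional (functional_gA k S);
  tp_P1 : (#|Ext P| = 2 \/ #|Ext P| = 3)%N;
  tp_P2 : binary_spectrum (gA_lie k P);
  tp_P3 : contractible R (realization R (order_complex P));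
  tp_F1 : small S;
  tp_F2 : [/\ order_filter (sinks S), order_ideal (sources S)
            & inner_vertices S = finset.set0];
  tp_F3 : forall p q : P, p \in Ext P -> q \in Ext P -> (p < q)%O ->
            (p, q) \in S;
  tp_F4 : forall B : g_lie k P, B \in form_ker (functional_g k S) ->
            (forall p q : P, Estar k p p (vsval B) = Estar k q q (vsval B)) /\
            (forall p q : P, (p < q)%O -> Estar k p q (vsval B) = 0)
}.

Section Gluing.
Variables (dS dQ : Order.disp_t) (S : finPOrderType dS) (Q : finPOrderType dQ).
Local Open Scope set_scope.

Definition ext2 (a b : S) : Prop :=
  [/\ Ext S = [set a; b], #|Ext S| = 2%N & ((a <= b) || (b <= a))%O].

Definition ext3 (a b c : S) : Prop :=
  [/\ Ext S = [set a; b; c], #|Ext S| = 3%N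
    & ((a <= b) && (a <= c) || (b <= a) && (c <= a))%O].

Definition ext_ab (a b : S) : Prop := ext2 a b \/ exists c, ext3 a b c.

(* [rule ids]: some rule glues S and Q by identifying s with q exactly for the
   pairs (s, q) in ids. *)
Inductive rule : seq (S * Q) -> Prop :=
| rule_A1 a b y : ext_ab a b -> y \in Ext Q -> rule [:: (b, y)]
| rule_C a b x : ext_ab a b -> x \in Ext Q -> rule [:: (a, x)]
| rule_E1 a b x y : ext_ab a b -> x \in Ext Q -> y \in Ext Q ->
    ~~ (x >=< y)%O -> rule [:: (a, x); (b, y)]
| rule_A2 a b c z : ext3 a b c -> z \in Ext Q -> rule [:: (c, z)]
| rule_B a b c y z : ext3 a b c -> y \in Ext Q -> z \in Ext Q ->
    rule [:: (b, y); (c, z)]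
| rule_D1 a b c x y : ext3 a b c -> x \in Ext Q -> y \in Ext Q ->
    (x >=< y)%O -> rule [:: (a, x); (b, y)]
| rule_D2 a b c x z : ext3 a b c -> x \in Ext Q -> z \in Ext Q ->
    (x >=< z)%O -> rule [:: (a, x); (c, z)]
| rule_E2 a b c x z : ext3 a b c -> x \in Ext Q -> z \in Ext Q ->
    ~~ (x >=< z)%O -> rule [:: (a, x); (c, z)]
| rule_F a b c x y z : ext3 a b c ->
    x \in Ext Q -> y \in Ext Q -> z \in Ext Q ->
    (x >=< y)%O -> (x >=< z)%O -> rule [:: (a, x); (b, y); (c, z)]
| rule_G1 a b c x y z : ext3 a b c ->
    x \in Ext Q -> y \in Ext Q -> z \in Ext Q ->
    (x >=< y)%O -> ~~ (x >=< z)%O -> rule [:: (a, x); (b, y); (c, z)]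
| rule_G2 a b c x y z : ext3 a b c ->
    x \in Ext Q -> y \in Ext Q -> z \in Ext Q ->
    ~~ (x >=< y)%O -> (x >=< z)%O -> rule [:: (a, x); (b, y); (c, z)]
| rule_H a b c x y z : ext3 a b c ->
    x \in Ext Q -> y \in Ext Q -> z \in Ext Q ->
    ~~ (x >=< y)%O -> ~~ (x >=< z)%O -> rule [:: (a, x); (b, y); (c, z)].

(* P is the union of the copies f(S) and g(Q), meeting exactly in the identified
   elements.  Its order is the plain union of the two orders: since minimal
   elements are only identified with minimal ones, and maximal ones with maximal
   ones, no relation arises by transitivity through an identified element. *)
Record glued (dP : Order.disp_t) (P : finPOrderType dP) (ids : seq (S * Q))
    (f : S -> P) (g : Q -> P) : Prop := Glued {
  glued_extremal : forall s q, (s, q) \in ids ->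
    (minimal s && minimal q) || (maximal s && maximal q);
  glued_injl : injective f;
  glued_injr : injective g;
  glued_meet : forall s q, (f s == g q) = ((s, q) \in ids);
  glued_cover : forall p : P, (exists s, p = f s) \/ (exists q, p = g q);
  glued_le : forall p p' : P, (p <= p')%O <->
    (exists s s', [/\ p = f s, p' = f s' & (s <= s')%O]) \/
    (exists q q', [/\ p = g q, p' = g q' & (q <= q')%O])
}.

Definition formed_from (dP : Order.disp_t) (P : finPOrderType dP) : Prop :=
  exists ids f g, rule ids /\ @glued dP P ids f g.

End Gluing.

(* Derivations are construction sequences: [toral_base] is the first poset of
   the sequence and each [toral_step] goes from one poset to the next. *)
Inductive toral (R : realType) (k : fieldType) :
    forall d : Order.disp_t, finPOrderType d -> Prop :=
| toral_base d (S : finPOrderType d) (F : {set S * S}) :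
    toral_pair R k F -> toral R k S
| toral_step dQ (Q : finPOrderType dQ) dS (S : finPOrderType dS)
    (F : {set S * S}) dP (P : finPOrderType dP) :
    toral R k Q -> toral_pair R k F -> formed_from S Q P -> toral R k P.

(* Main.v *)
Require Import Defs.
From HB Require Import structures.
From mathcomp Require Import all_boot all_order all_algebra.
From mathcomp Require Import all_classical all_reals all_analysis.
From mathcomp Require Import zify.

(** Cut a poset [P] into an ideal [D] and its complement.  The relations from
    [D] to the complement span an abelian ideal [W] of the incidence Lie
    algebra, and the indicator of [D], shifted to trace zero, acts on the
    algebra as a projection onto [W].  Two facts about such a cut give the
    theorem.

    First, the Kirillov form of every functional vanishes on the abelian
    subalgebra [W]; if the form is nondegenerate, [W] is at most half of the
    algebra.  If [W] is exactly half, [W] is Lagrangian for every Frobenius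
    functional, so every principal element is the shifted indicator of [D] plus
    an element of [W].  Its adjoint action is again a projection onto [W]: half
    of the eigenvalues are 1 and the others are 0 ([half_abelian_binary]).  So
    the spectrum is binary as soon as some cut of [P] has enough relations going
    across it ([cut_binary]), and this is pure counting.

    Secondly, a toral poset has such a cut ([toral_light_cut]).  For a
    toral-pair take the sources of the functional [F].  Because [F] only sees
    relations going across the cut, the traceless matrices supported on the
    other relations form an isotropic subspace, hence at most half of the
    algebra ([card_uncut_le]).  The cuts separate minimal from maximal elements,
    so they agree on identified elements and glue.  Let [e] be the number of
    pairs [p <= q] not going across the cut ([p = q] included) minus the number
    of those going across.  The excess [e] of a glued cut is the sum of the
    excesses of the two pieces minus that of their common part, and a common
    part with one to three extremal elements has [e >= 1].  Hence [e <= 1]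
    survives each step ([light_cut_glued]), and [e <= 1] says that [W] is at
    least half of the algebra.  The steps that make [e] drop below 1 lead to
    posets where [W] exceeds half of the algebra; such posets are not
    Frobenius. *)

Set Implicit Arguments.
Unset Strict Implicit.
Unset Printing Implicit Defensive.
Import Order.TTheory GRing.Theory Num.Theory.
Local Open Scope ring_scope.

(** * Isotropic subspaces of a bilinear form *)

Section Bilinear.
Import VectorInternalTheory.
Variables (k : fieldType) (V : vectType k) (b : 'Hom(V, 'Hom(V, k^o))).

Lemma gram_matrixE :
  {B : 'M[k]_(dim V) | forall u v, b u v = (v2r u *m B *m (v2r v)^T) 0 0}.
Proof.
pose e (i : 'I_(dim V)) : V := r2v (delta_mx 0 i).
have decomp u : u = \sum_i v2r u 0 i *: e i.
  rewrite -[LHS]v2rK [X in r2v X = _]row_sum_delta linear_sum /=.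
  by apply: eq_bigr => i _; rewrite linearZ.
exists (\matrix_(i, j) b (e i) (e j)) => u v.
rewrite {1}(decomp v) linear_sum mxE; apply: eq_bigr => j _.
rewrite linearZ /= {1}(decomp u) linear_sum sum_lfunE !mxE [RHS]mulrC.
congr (_ * _); apply: eq_bigr => i _.
by rewrite linearZ scale_lfunE mxE.
Qed.

Hypothesis b_nondegenerate : lker b = 0%VS.

(** In coordinates the orthogonal of [W] is the kernel of [B *m W^T]; since the
    Gram matrix [B] is invertible, it has dimension [dim V - dim W], and it
    contains [W]. *)
Lemma isotropic_dim (W : {vspace V}) :
    {in W &, forall u v, b u v = 0} ->
  (\dim W + \dim W <= \dim {:V})%N /\
  ((\dim {:V} <= \dim W + \dim W)%N ->
    forall u, {in W, forall v, b u v = 0} -> u \in W).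
Proof.
move=> isoW; have [B BE] := gram_matrixE.
have memE u : (u \in W) = (v2r u <= vs2mx W)%MS by rewrite -genmxE.
have row_W i : r2v (row i (vs2mx W)) \in W by rewrite memE r2vK row_sub.
have B_unit : B \in unitmx.
  rewrite -row_free_unit -kermx_eq0; apply/eqP/row_matrixP => i; rewrite row0.
  apply: (can_inj r2vK); rewrite linear0; apply/eqP.
  rewrite -memv0 -b_nondegenerate memv_ker; apply/eqP/lfunP => v.
  by rewrite zero_lfunE BE r2vK -row_mul mulmx_ker row0 mul0mx mxE.
have WBE u i : b u (r2v (row i (vs2mx W))) = (v2r u *m (B *m (vs2mx W)^T)) 0 i.
  by rewrite BE r2vK tr_row colE !mulmxA -colE mxE.
have WB : (vs2mx W <= kermx (B *m (vs2mx W)^T))%MS.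
  apply/sub_kermxP/matrixP => i j; rewrite [RHS]mxE.
  have := isoW _ _ (row_W i) (row_W j); rewrite WBE r2vK -row_mul => <-.
  by rewrite !mxE.
have rk : \rank (kermx (B *m (vs2mx W)^T)) = (\dim {:V} - \dim W)%N.
  rewrite mxrank_ker eqmxMfull ?row_full_unit // mxrank_tr.
  by rewrite {1}/dimv /= genmx1 mxrank1.
have dimW : (\dim W <= \dim {:V})%N by rewrite dimvS ?subvf.
have leW := mxrankS WB; rewrite rk -/(\dim W) leq_subRL // in leW.
split=> // geW u bu; rewrite memE.
have : (kermx (B *m (vs2mx W)^T) <= vs2mx W)%MS.
  have /mxrank_leqif_sup[_ <-] := WB.
  by rewrite rk -/(\dim W) eqn_leq leq_subRL // leW leq_subLR.
apply: submx_trans; apply/sub_kermxP/rowP => i.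
by rewrite -WBE bu // mxE.
Qed.
End Bilinear.

(** * Characteristic polynomial of a projection *)

Section Idempotent.
Import VectorInternalTheory.
Variable k : fieldType.

Lemma rank_b2mx (V : vectType k) n (X : n.-tuple V) :
  free X -> \rank (b2mx X) = n.
Proof.
move=> /eqP; rewrite size_tuple /dimv.
have -> : <<X>>%VS = mx2vs (b2mx X) by rewrite unlock tvalK; case: _ / (esym _).
by rewrite /= genmxE.
Qed.

Lemma rank_mxof (V : vectType k) (e : (\dim {:V}).-tuple V) (f : 'End(V)) :
  basis_of {:V} e -> \rank (passmx.mxof e e f) = \dim (limg f).
Proof.
move=> eb; set A := passmx.mxof e e f; have [_ e_free] := andP eb.
have vecE u : v2r (passmx.vecof e u) = u *m b2mx e.
  rewrite mulmx_sum_row linear_sum; apply: eq_bigr => i _.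
  by rewrite linearZ rowK (tnth_nth 0).
have rkE := rank_b2mx e_free.
have AE : A *m b2mx e = b2mx e *m f2mx f.
  apply/row_matrixP => i; rewrite !row_mul -vecE rowE passmx.mul_mxof.
  by rewrite passmx.rVofK // passmx.vecof_delta rowK (tnth_nth 0) unlock /= r2vK.
rewrite -(mxrankMfree A (B := b2mx e)) ?AE; last by rewrite /row_free rkE.
rewrite eqmxMfull; last by rewrite /row_full rkE dimvf.
have -> : limg f = mx2vs (vs2mx {:V} *m f2mx f) by rewrite /lfun_img locked_withE.
by rewrite /dimv /= genmxE eqmxMfull // /row_full genmxE mxrank1.
Qed.

Lemma char_poly_conj n (A T : 'M[k]_n) :
  T \in unitmx -> char_poly (T *m A *m invmx T) = char_poly A.
Proof.
move=> Tu; rewrite /char_poly /char_poly_mx.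
pose C (M : 'M[k]_n) := map_mx polyC M.
have TT : C T *m C (invmx T) = 1%:M by rewrite -map_mxM mulmxV // map_mx1.
have -> : 'X%:M - C (T *m A *m invmx T) = C T *m ('X%:M - C A) *m C (invmx T).
  rewrite mulmxBr mulmxBl scalar_mxC -(mulmxA 'X%:M) TT mulmx1.
  by rewrite /C !map_mxM.
by rewrite !det_mulmx mulrAC -det_mulmx TT det1 mul1r.
Qed.

Lemma mulmx_pid_mxE m n r (A : 'M[k]_(m, n)) i j :
  (A *m (pid_mx r : 'M[k]_n)) i j = A i j *+ (j < r).
Proof.
rewrite mxE (bigD1 j) //= big1 => [|l /negPf lj].
  by rewrite mxE eqxx addr0 mulr_natr.
by rewrite mxE val_eqE lj mulr0.
Qed.

Lemma mul_pid_mxE m n r (A : 'M[k]_(m, n)) i j :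
  ((pid_mx r : 'M[k]_m) *m A) i j = A i j *+ (i < r).
Proof.
rewrite mxE (bigD1 i) //= big1 => [|l /negPf li].
  by rewrite mxE eqxx addr0 mulr_natl.
by rewrite mxE val_eqE eq_sym li mul0r.
Qed.

(** Gaussian elimination writes [A] as [L *m pid_mx r *m U] with [L] and [U]
    invertible, so [A] is similar to [K *m pid_mx r] with [K = U *m L].
    Idempotence forces the upper left block of [K] to be the identity, and
    [K *m pid_mx r] is then lower triangular with [r] ones on the diagonal. *)
Lemma char_poly_idempotent n (A : 'M[k]_n) :
  A *m A = A -> char_poly A = 'X ^+ (n - \rank A) * ('X - 1) ^+ \rank A.
Proof.
set r := \rank A => AA.
have Lu := col_ebase_unit A; have Uu := row_ebase_unit A.
set L := col_ebase A in Lu; set U := row_ebase A in Uu.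
have AE : L *m pid_mx r *m U = A by exact: mulmx_ebase.
set K := U *m L.
have pK : pid_mx r *m K *m pid_mx r = pid_mx r :> 'M[k]_n.
  apply: (can_inj (mulKmx Lu)); apply: (can_inj (mulmxK Uu)).
  transitivity (L *m pid_mx r *m U *m (L *m pid_mx r *m U)).
    by rewrite /K !mulmxA.
  by rewrite AE AA.
have KE (i j : 'I_n) : (i < r)%N -> (j < r)%N -> K i j = (i == j)%:R.
  move=> ir jr; move/matrixP/(_ i j): pK; rewrite [RHS]mxE ir andbT => <-.
  by rewrite mulmx_pid_mxE mul_pid_mxE ir jr.
have -> : char_poly A = char_poly (K *m pid_mx r).
  rewrite -(char_poly_conj A Uu) -{1}AE; congr char_poly.
  by rewrite !mulmxA mulmxK.
rewrite char_poly_trig; last first.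
  apply/is_trig_mxP => i j ij; rewrite mulmx_pid_mxE; case: ltnP => // jr.
  by rewrite KE ?(ltn_trans ij) // -val_eqE ltn_eqF.
under eq_bigr => i _.
  rewrite mulmx_pid_mxE (_ : K i i *+ _ = (i < r)%:R); last first.
    by case: ltnP => // ir; rewrite KE // eqxx.
  over.
have rn : (r <= n)%N by exact: rank_leq_row.
rewrite -(big_mkord xpredT (fun i => 'X - ((i < r)%:R)%:P)).
rewrite (big_cat_nat (n := r)) //= mulrC.
congr (_ * _).
  rewrite big_nat (eq_bigr (fun=> 'X)) => [|i /andP[ri _]]; last first.
    by rewrite ltnNge ri subr0.
  by rewrite -big_nat prodr_const_nat.
rewrite big_nat (eq_bigr (fun=> 'X - 1)) => [|i /andP[_ ->]]; last by rewrite polyC1.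
by rewrite -big_nat prodr_const_nat subn0.
Qed.

Lemma char_poly_idempotent_lfun (V : vectType k) (f : 'End(V)) m :
    (f \o f = f)%VF -> \dim (limg f) = m -> \dim {:V} = (m + m)%N ->
  char_poly (passmx.mxof (vbasis {:V}) (vbasis {:V}) f)
    = \prod_(a <- nseq m 0 ++ nseq m 1) ('X - a%:P).
Proof.
move=> ff dimf dimV; set e := vbasis {:V}; have eb : basis_of {:V} e by exact: vbasisP.
set A := passmx.mxof e e f.
have AA : A *m A = A by rewrite -passmx.mxof_comp // ff.
have rkA : \rank A = m by rewrite rank_mxof.
rewrite char_poly_idempotent // rkA dimV addnK big_cat /= !big_nseq.
by rewrite !iter_mulr_1 subr0 polyC1.
Qed.
End Idempotent.

(** * Lie algebras with a half-dimensional abelian ideal *)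

Section Lie.
Variables (k : fieldType) (L : lieAlgebra k).
Implicit Types (F : 'Hom(L, k^o)) (W : {vspace L}).

Lemma frobenius_isotropic F W :
    frobenius_functional F -> {in W &, forall u v, F (lie_br u v) = 0} ->
  (\dim W + \dim W <= \dim {:L})%N /\
  ((\dim {:L} <= \dim W + \dim W)%N ->
    forall u, {in W, forall v, F (lie_br u v) = 0} -> u \in W).
Proof.
move=> /eqP; rewrite dimv_eq0 => /eqP F0 isoW.
have lin : linear (fun x : L => (F \o ad x)%VF).
  move=> a u v; apply/lfunP => y.
  by rewrite add_lfunE scale_lfunE !comp_lfunE !adE lie_br_linearl linearP.
pose f : {linear L -> 'Hom(L, k^o)} :=
  HB.pack (fun x : L => (F \o ad x)%VF) (GRing.isLinear.Build k L _ *:%R _ lin).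
have bE u v : linfun f u v = F (lie_br u v) by rewrite lfunE /= comp_lfunE adE.
have [|le ge] := isotropic_dim F0 (W := W).
  by move=> u v uW vW; rewrite bE isoW.
split=> // /ge{}ge u uW; apply: ge => v vW; by rewrite bE uW.
Qed.

Lemma lie_brC (x y : L) : lie_br x y = - lie_br y x.
Proof.
have brDl u v w : lie_br (u + v) w = lie_br u w + lie_br v w :> L.
  by have := lie_br_linearl w 1 u v; rewrite !scale1r.
have brDr u v w : lie_br u (v + w) = lie_br u v + lie_br u w :> L.
  by have := lie_br_linearr u 1 v w; rewrite !scale1r.
apply/eqP; rewrite -addr_eq0; apply/eqP.
by have := lie_br_alt (x + y); rewrite brDl !brDr !lie_br_alt add0r addr0.
Qed.

(** Bracketing with [h] is a projection onto [W], so [h] behaves as a principal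
    element against [W] whatever the Frobenius functional [F] is.  The true
    principal element differs from [h] by an element orthogonal to [W] for the
    Kirillov form, and [W] is its own orthogonal.  Adding an element of [W] to
    [h] does not change that the adjoint action is a projection onto [W]. *)
Lemma half_abelian_binary (h : L) W :
    {in W &, forall u v, lie_br u v = 0} -> (forall u, lie_br h u \in W) ->
    {in W, forall w, lie_br h w = w} -> (\dim {:L} <= \dim W + \dim W)%N ->
  frobenius L -> binary_spectrum L.
Proof.
move=> abW hW h1 dimW frobL; exists (\dim W); split=> // F x F0 Fx.
have isoW : {in W &, forall u v, F (lie_br u v) = 0}.
  by move=> u v uW vW; rewrite abW // linear0.
have [le /(_ dimW) perpW] := frobenius_isotropic F0 isoW.
(* [W] is an ideal: rewrite [w] as [[h, w]] and use the Jacobi identity. *)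
have brW u w : w \in W -> lie_br u w \in W.
  move=> wW; have := lie_jacobi h w u.
  rewrite (h1 w wW) (abW w (lie_br u h)) ?addr0; first last.
  - by rewrite lie_brC memvN hW.
  - by [].
  by move=> /eqP; rewrite addrC addr_eq0 => /eqP ->; rewrite memvN hW.
have brD y z u : lie_br (y + z) u = lie_br y u + lie_br z u :> L.
  by have := lie_br_linearl u 1 y z; rewrite !scale1r.
have [b bW ->] : exists2 b, b \in W & x = h + b.
  exists (x - h); last by rewrite addrC subrK.
  apply: perpW => w wW.
  have -> : lie_br (x - h) w = lie_br x w - lie_br h w :> L.
    have := lie_br_linearl w (-1) h x; rewrite !scaleN1r /= => E.
    by rewrite [x - h]addrC E [RHS]addrC.
  by rewrite linearB /= Fx h1 // subrr.
set A := ad _.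
have Aw w : w \in W -> A w = w.
  by move=> wW; rewrite adE brD h1 // abW // addr0.
have AW u : A u \in W.
  by rewrite adE brD memvD // lie_brC memvN brW.
apply: char_poly_idempotent_lfun.
- by apply/lfunP => u; rewrite comp_lfunE Aw.
- congr (\dim _); apply: subv_anti; apply/andP; split.
    by apply/subvP => _ /memv_imgP[u _ ->].
  by apply/subvP => w wW; rewrite -(Aw w wW) memv_img ?memvf.
- by apply/eqP; rewrite eqn_leq dimW le.
Qed.
End Lie.

(** * Cuts of a poset *)

Section Cut.
Variables (d : Order.disp_t) (P : finPOrderType d) (D : {set P}).

Definition uncut_rel : {set P * P} :=
  [set e | (e.1 <= e.2)%O && ((e.1 \in D) == (e.2 \in D))]%SET.
Definition cut_rel : {set P * P} :=
  [set e | [&& (e.1 <= e.2)%O, e.1 \in D & e.2 \notin D]]%SET.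

Lemma card_le_rel : order_ideal D ->
  #|[set e : P * P | (e.1 <= e.2)%O]%SET| = (#|uncut_rel| + #|cut_rel|)%N.
Proof.
move=> idD; have <- := cardsID uncut_rel [set e : P * P | (e.1 <= e.2)%O]%SET.
congr (_ + _)%N.
  by apply: eq_card => -[p q]; rewrite !inE /=; case: (p <= q)%O.
apply: eq_card => -[p q]; rewrite !inE /=.
case: (boolP (p <= q)%O) => pq; rewrite ?andbF //= andbT.
have [qD|_] := boolP (q \in D); last by case: (p \in D).
by rewrite (idD _ _ qD pq).
Qed.
End Cut.

(** * Matrices supported on a set of relations *)

Section Support.
Variables (k : fieldType) (d : Order.disp_t) (P : finPOrderType d).
Implicit Types (E : {set P * P}) (A B : 'M[k]_#|{: P}|) (D : {set P}).

Definition supp_space E : {vspace 'M[k]_#|{: P}|} :=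
  <<[seq Emx k e.1 e.2 | e <- enum E]>>%VS.

Lemma span_Emx_eq0 (s : seq (P * P)) B p q :
    B \in <<[seq Emx k e.1 e.2 | e <- s]>>%VS -> (p, q) \notin s ->
  B (enum_rank p) (enum_rank q) = 0.
Proof.
move=> Bs npq; rewrite -EstarE.
have /subvP/(_ B Bs) : (<<[seq Emx k e.1 e.2 | e <- s]>> <= lker (Estar k p q))%VS.
  apply/span_subvP => _ /mapP[[r t] rt ->].
  rewrite memv_ker EstarE mxE /= !(inj_eq enum_rank_inj).
  by case: (p =P _) => //= pr; case: (q =P _) => //= qt; rewrite pr qt rt in npq.
by rewrite memv_ker => /eqP.
Qed.

Lemma mem_supp_spaceP E B :
  reflect (forall i j, (enum_val i, enum_val j) \notin E -> B i j = 0)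
    (B \in supp_space E).
Proof.
apply: (iffP idP) => [BE i j nij | B0].
  have := span_Emx_eq0 BE (p := enum_val i) (q := enum_val j).
  by rewrite !enum_valK mem_enum; apply.
rewrite (matrix_sum_delta B); apply: memv_suml => i _; apply: memv_suml => j _.
have [ijE|/B0->] := boolP ((enum_val i, enum_val j) \in E); last first.
  by rewrite scale0r mem0v.
apply: memvZ; apply: memv_span; apply/mapP; exists (enum_val i, enum_val j).
  by rewrite mem_enum.
by rewrite /Emx !enum_valK.
Qed.

Lemma dim_supp_space E : \dim (supp_space E) = #|E|.
Proof.
rewrite cardE -(size_map (fun e => Emx k e.1 e.2)); apply/eqP; rewrite -/(free _).
elim: (enum E) (enum_uniq E) => [_|[p q] s IH /= /andP[npq us]]; first exact: nil_free.
rewrite free_cons IH // andbT; apply/negP => /span_Emx_eq0 /(_ npq)/eqP.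
by rewrite mxE !eqxx oner_eq0.
Qed.

Lemma g_spaceE : g_space k P = supp_space [set e | (e.1 <= e.2)%O]%SET.
Proof. by []. Qed.

Let tr : 'Hom('M[k]_#|{: P}|, k^o) := linfun (fun B : 'M[k]__ => \tr B : k^o).

Let trE B : tr B = \tr B.
Proof.
have lin : linear (fun C : 'M[k]_#|{: P}| => \tr C : k^o).
  by move=> a u v; rewrite linearP.
pose g : {linear 'M[k]_#|{: P}| -> k^o} :=
  HB.pack (fun C : 'M[k]_#|{: P}| => \tr C : k^o)
    (GRing.isLinear.Build k _ k^o *:%R _ lin).
exact: (lfunE g).
Qed.

Lemma dim_gA_space (p0 : P) :
  \dim (gA_space k P) = #|[set e : P * P | (e.1 <= e.2)%O]%SET|.-1.
Proof.
rewrite -dim_supp_space -g_spaceE; have <- := limg_ker_dim tr (g_space k P).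
suff -> : (tr @: g_space k P)%VS = fullv.
  by rewrite dimvf addn1.
apply/eqP; rewrite eqEsubv subvf /=; apply/subvP => c _.
have -> : c = tr (c *: Emx k p0 p0).
  rewrite linearZ /= trE /mxtrace (bigD1 (enum_rank p0)) //= mxE !eqxx.
  rewrite big1 ?addr0 => [|i]; first by rewrite [RHS]mulr1.
  move=> /negPf ni; by rewrite mxE ni.
apply: memv_img; apply: memvZ; apply: memv_span; apply/mapP.
by exists (p0, p0) => //; rewrite mem_enum inE lexx.
Qed.

Lemma dim_gA_lie (p0 : P) :
  \dim {: gA_lie k P} = #|[set e : P * P | (e.1 <= e.2)%O]%SET|.-1.
Proof. by rewrite -(dim_gA_space p0) dimvf. Qed.

Lemma card_le_dim_traceless E :
  (#|E| <= (\dim (supp_space E :&: lker tr)%VS).+1)%N.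
Proof.
rewrite -dim_supp_space -(limg_ker_dim tr) -addn1 leq_add2l.
by apply: leq_trans (dimvS (subvf _)) _; rewrite dimvf.
Qed.

Lemma mem_traceless E B :
  (B \in (supp_space E :&: lker tr)%VS) = (B \in supp_space E) && (\tr B == 0).
Proof. by rewrite memv_cap memv_ker trE. Qed.

Lemma supp_spaceS E E' : E \subset E' -> (supp_space E <= supp_space E')%VS.
Proof.
move=> /fintype.subsetP EE'; apply/subvP => B /mem_supp_spaceP BE.
by apply/mem_supp_spaceP => i j nij; apply: BE; apply: contra nij; apply: EE'.
Qed.

Lemma dim_gA_preim (V : {vspace 'M[k]_#|{: P}|}) : (V <= gA_space k P)%VS ->
  \dim (linfun (vsval (U := gA_space k P)) @^-1: V)%VS = \dim V.
Proof.
set f := linfun _ => VA.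
have fE x : f x = vsval x by rewrite lfunE.
have Vf : (V <= limg f)%VS.
  apply/subvP => B BV; have BA := subvP VA B BV.
  by rewrite -[B](vsprojK BA) -fE memv_img ?memvf.
rewrite -[in RHS](lpreimK Vf) limg_dim_eq //.
apply/eqP; rewrite -subv0; apply/subvP => x.
rewrite memv_cap memv_ker fE => /andP[_ /eqP x0].
by rewrite memv0; apply/eqP/val_inj.
Qed.

Lemma mem_gA_preim (V : {vspace 'M[k]_#|{: P}|}) (x : gA_lie k P) :
  (x \in linfun (vsval (U := gA_space k P)) @^-1: V)%VS = (vsval x \in V).
Proof. by rewrite -memv_preim lfunE. Qed.

(** Two relations across the cut never compose: the first ends outside [D],
    where the second would have to start. *)
Lemma cut_mul_eq0 D A B :
  A \in supp_space (cut_rel D) -> B \in supp_space (cut_rel D) -> A *m B = 0.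
Proof.
move=> /mem_supp_spaceP A0 /mem_supp_spaceP B0.
apply/matrixP => i j; rewrite !mxE big1 // => l _.
have [lD|lD] := boolP (enum_val l \in D).
  by rewrite A0 ?mul0r // inE /= lD /= !andbF.
by rewrite B0 ?mulr0 // inE /= (negPf lD) andbF.
Qed.

Lemma uncut_mul D A B :
    A \in supp_space (uncut_rel D) -> B \in supp_space (uncut_rel D) ->
  A *m B \in supp_space (uncut_rel D).
Proof.
move=> /mem_supp_spaceP A0 /mem_supp_spaceP B0.
apply/mem_supp_spaceP => i j nij; rewrite mxE big1 // => l _.
have [il|/A0->] := boolP ((enum_val i, enum_val l) \in uncut_rel D); last first.
  by rewrite mul0r.
have [lj|/B0->] := boolP ((enum_val l, enum_val j) \in uncut_rel D); last first.
  by rewrite mulr0.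
move: il lj nij; rewrite !inE /= => /andP[il /eqP->] /andP[lj /eqP->].
by rewrite (le_trans il lj) eqxx.
Qed.

(** The indicator of [D]; the shift by a scalar matrix, invisible to brackets,
    makes the trace vanish. *)
Definition cut_element D : 'M[k]_#|{: P}| :=
  diag_mx (\row_i ((enum_val i \in D)%:R - #|D|%:R / #|P|%:R)).

Lemma commutator_cut_element D B i j :
  commutator (cut_element D) B i j
    = ((enum_val i \in D)%:R - (enum_val j \in D)%:R) * B i j.
Proof.
rewrite /commutator mul_diag_mx mul_mx_diag !mxE [B i j * _]mulrC -mulrBl.
by rewrite opprD addrACA opprK addNr addr0.
Qed.

Lemma cut_element_gA D : #|P|%:R != 0 :> k -> cut_element D \in gA_space k P.
Proof.
move=> n0; rewrite mem_gA_space; apply/andP; split.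
  apply/mem_supp_spaceP => i j; rewrite !inE /= !mxE.
  by case: eqP => [->|]; rewrite ?lexx ?mulr0n.
rewrite /cut_element mxtrace_diag.
under eq_bigr => i _ do rewrite mxE.
rewrite sumrB sumr_const card_ord -[_ *+ _]mulr_natr mulfVK // subr_eq0.
rewrite -(big_enum_val (fun p => (p \in D)%:R)) /= -natr_sum -sum1_card.
by apply/eqP; congr _%:R; rewrite [RHS]big_mkcond; apply: eq_bigr => p _; case: ifP.
Qed.

Lemma commutator_cut_elementP D B : order_ideal D -> B \in g_space k P ->
  commutator (cut_element D) B \in supp_space (cut_rel D).
Proof.
move=> idD /mem_supp_spaceP B0; apply/mem_supp_spaceP => i j nij.
rewrite commutator_cut_element; move: nij (B0 i j); rewrite !inE /=.
case: (boolP (enum_val i <= enum_val j)%O) => /= [le nij _|_ _ ->]; rewrite ?mulr0 //.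
case: (boolP (enum_val j \in D)) nij => jD; first by rewrite (idD _ _ jD le) subrr mul0r.
by rewrite andbT => /negPf ->; rewrite subrr mul0r.
Qed.

Lemma commutator_cut_element_id D B : B \in supp_space (cut_rel D) ->
  commutator (cut_element D) B = B.
Proof.
move=> /mem_supp_spaceP B0; apply/matrixP => i j; rewrite commutator_cut_element.
have [|/B0->] := boolP ((enum_val i, enum_val j) \in cut_rel D); last by rewrite mulr0.
by rewrite inE /= => /and3P[_ -> /negPf ->]; rewrite subr0 mul1r.
Qed.

Lemma cut_gA D : (supp_space (cut_rel D) <= gA_space k P)%VS.
Proof.
apply/subvP => B /mem_supp_spaceP B0; rewrite mem_gA_space; apply/andP; split.
  apply/mem_supp_spaceP => i j; rewrite inE => nij; apply: B0; rewrite inE.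
  by rewrite (negPf nij).
rewrite /mxtrace big1 // => i _; apply: B0; rewrite inE /=.
by case: (_ \in D); rewrite !andbF.
Qed.

(** The cardinality bound says that the relations across the cut span at least
    half of the algebra, as the trace condition removes one dimension; they are
    the abelian subalgebra of [half_abelian_binary].
    Characteristic zero serves to divide by [#|P|] in [cut_element]. *)
Lemma cut_binary D (p0 : P) :
    [pchar k] =i pred0 -> order_ideal D ->
    (#|uncut_rel D| <= #|cut_rel D|.+1)%N ->
  frobenius (gA_lie k P) -> binary_spectrum (gA_lie k P).
Proof.
move=> k0 idD leD frobP.
pose W : {vspace gA_lie k P} :=
  (linfun (vsval (U := gA_space k P)) @^-1: supp_space (cut_rel D))%VS.
have dimW : \dim W = #|cut_rel D|.
  by rewrite dim_gA_preim ?cut_gA // dim_supp_space.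
have n0 : #|P|%:R != 0 :> k.
  by rewrite ((pcharf0P k).1 k0) -lt0n; apply/card_gt0P; exists p0.
pose h : gA_lie k P := Subvs (cut_element_gA D n0).
have gAg (x : gA_lie k P) : vsval x \in g_space k P.
  by have := subvsP x; rewrite mem_gA_space => /andP[].
apply: (half_abelian_binary (h := h) (W := W)) => //.
- move=> u v; rewrite !mem_gA_preim => uW vW; apply: val_inj.
  by rewrite /= /commutator !(cut_mul_eq0 (D := D)) // subr0.
- by move=> u; rewrite mem_gA_preim commutator_cut_elementP.
- move=> w; rewrite mem_gA_preim => wW; apply: val_inj.
  exact: commutator_cut_element_id.
- rewrite dimW (dim_gA_lie p0) (card_le_rel idD).
  by rewrite -subn1 leq_subLR addnA add1n leq_add2r.
Qed.

(** A functional that sees only relations across the cut vanishes on the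
    matrices supported on the other relations.  These are closed under
    multiplication, so the traceless ones are isotropic for the Kirillov form
    and make up at most half of the algebra. *)
Lemma card_uncut_le D (p0 : P) (T : {set P * P}) :
    order_ideal D -> frobenius_functional (functional_gA k T) ->
    (forall e, e \in T -> e.1 \in D /\ e.2 \notin D) ->
  (#|uncut_rel D| <= #|cut_rel D|.+1)%N.
Proof.
move=> idD F0 TD.
pose V := (supp_space (uncut_rel D) :&: lker tr)%VS.
pose W : {vspace gA_lie k P} :=
  (linfun (vsval (U := gA_space k P)) @^-1: V)%VS.
have VA : (V <= gA_space k P)%VS.
  apply/subvP => B; rewrite mem_traceless mem_gA_space => /andP[+ ->].
  rewrite andbT; apply/subvP; apply: supp_spaceS; apply/fintype.subsetP => e.
  by rewrite !inE => /andP[].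
have dimW : \dim W = \dim V by exact: dim_gA_preim.
have isoW : {in W &, forall u v, functional_gA k T (lie_br u v) = 0}.
  move=> u v; rewrite !mem_gA_preim !mem_traceless => /andP[uV _] /andP[vV _].
  have : commutator (vsval u) (vsval v) \in supp_space (uncut_rel D).
    by rewrite rpredB // uncut_mul.
  move=> /mem_supp_spaceP c0.
  rewrite comp_lfunE lfunE /= /functional sum_lfunE big1 // => e /TD[eD1 eD2].
  by rewrite EstarE c0 // !enum_rankK inE /= eD1 (negPf eD2) andbF.
have [+ _] := frobenius_isotropic F0 isoW.
rewrite dimW (dim_gA_lie p0) (card_le_rel idD).
have := card_le_dim_traceless (uncut_rel D); rewrite -/V; lia.
Qed.
End Support.

(** * Light cuts of toral posets *)

(** Light refers to the few relations away from the cut.  The conditions on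
    minimal and maximal elements make the cuts of two posets agree on the
    elements that a gluing identifies. *)
Record light_cut (d : Order.disp_t) (P : finPOrderType d) (D : {set P}) : Prop :=
  LightCut {
    light_ideal : order_ideal D;
    light_minimal : forall p, minimal p -> p \in D;
    light_maximal : forall p, maximal p -> p \notin D;
    light_card : (#|uncut_rel D| <= #|cut_rel D|.+1)%N
  }.

Section Glue.
Variables (dS dQ dP : Order.disp_t).
Variables (S : finPOrderType dS) (Q : finPOrderType dQ) (P : finPOrderType dP).
Variables (ids : seq (S * Q)) (f : S -> P) (g : Q -> P).
Hypothesis PSQ : glued ids f g.
Variables (DS : {set S}) (DQ : {set Q}).
Hypotheses (lightS : light_cut DS) (lightQ : light_cut DQ).

Let f_le s s' : (s <= s')%O -> (f s <= f s')%O.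
Proof. by move=> le; apply/(glued_le PSQ); left; exists s, s'. Qed.

Let g_le q q' : (q <= q')%O -> (g q <= g q')%O.
Proof. by move=> le; apply/(glued_le PSQ); right; exists q, q'. Qed.

Let f_minimal s : minimal (f s) -> minimal s.
Proof.
move=> /forallP m; apply/forallP => s'; apply/implyP => /f_le le.
by have := m (f s'); rewrite le (inj_eq (glued_injl PSQ)).
Qed.

Let g_minimal s : minimal (g s) -> minimal s.
Proof.
move=> /forallP m; apply/forallP => s'; apply/implyP => /g_le le.
by have := m (g s'); rewrite le (inj_eq (glued_injr PSQ)).
Qed.

Let f_maximal s : maximal (f s) -> maximal s.
Proof.
move=> /forallP m; apply/forallP => s'; apply/implyP => /f_le le.
by have := m (f s'); rewrite le (inj_eq (glued_injl PSQ)).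
Qed.

Let g_maximal s : maximal (g s) -> maximal s.
Proof.
move=> /forallP m; apply/forallP => s'; apply/implyP => /g_le le.
by have := m (g s'); rewrite le (inj_eq (glued_injr PSQ)).
Qed.

Let D : {set P} := ((f @: DS) :|: (g @: DQ))%SET.

Let ids_cut s q : (s, q) \in ids -> (s \in DS) = (q \in DQ).
Proof.
case/(glued_extremal PSQ)/orP => /andP[sm qm].
  by rewrite (light_minimal lightS sm) (light_minimal lightQ qm).
by rewrite (negPf (light_maximal lightS sm)) (negPf (light_maximal lightQ qm)).
Qed.

Let fD s : (f s \in D) = (s \in DS).
Proof.
rewrite inE (mem_imset _ _ (glued_injl PSQ)) orbC.
case: imsetP => //= -[q qD /eqP]; rewrite (glued_meet PSQ) => /ids_cut ->.
by rewrite qD.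
Qed.

Let gD q : (g q \in D) = (q \in DQ).
Proof.
rewrite inE (mem_imset _ _ (glued_injr PSQ)).
case: imsetP => //= -[s sD /eqP]; rewrite eq_sym (glued_meet PSQ) => /ids_cut <-.
by rewrite sD.
Qed.

Let F (e : S * S) : P * P := (f e.1, f e.2).
Let G (e : Q * Q) : P * P := (g e.1, g e.2).

Let F_inj : injective F.
Proof. by move=> [a b] [a' b'] [/(glued_injl PSQ)-> /(glued_injl PSQ)->]. Qed.

Let G_inj : injective G.
Proof. by move=> [a b] [a' b'] [/(glued_injr PSQ)-> /(glued_injr PSQ)->]. Qed.

(* Taking [c] to be equality, respectively [a && ~~ b], gives the uncut and the
   cut relations. *)
Let relE (c : rel bool) :
  [set e : P * P | (e.1 <= e.2)%O && c (e.1 \in D) (e.2 \in D)]%SET =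
  (F @: [set e : S * S | (e.1 <= e.2)%O && c (e.1 \in DS) (e.2 \in DS)] :|:
   G @: [set e : Q * Q | (e.1 <= e.2)%O && c (e.1 \in DQ) (e.2 \in DQ)])%SET.
Proof.
apply/setP => -[p p']; rewrite [LHS]finset.in_set [RHS]finset.in_setU /=.
apply/andP/orP.
  case=> /(glued_le PSQ) [[s [s' [-> -> le]]]|[q [q' [-> -> le]]]] cc.
    left; apply/imsetP; exists (s, s') => //.
    by rewrite inE /= le -!fD cc.
  right; apply/imsetP; exists (q, q') => //.
  by rewrite inE /= le -!gD cc.
case=> /imsetP[[a b]]; rewrite inE /= => /andP[le cc] [-> ->].
  by rewrite !fD f_le.
by rewrite !gD g_le.
Qed.

Let T : {set P} := (f @: finset.setT :&: g @: finset.setT)%SET.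

Let T_card : (#|T| <= #|Ext S|)%N.
Proof.
apply: leq_trans (leq_imset_card f (Ext S)); apply: subset_leq_card.
apply/fintype.subsetP => p; rewrite inE => /andP[/imsetP[s _ ->] /imsetP[q _ /eqP]].
rewrite (glued_meet PSQ) => /(glued_extremal PSQ) sq; apply: imset_f.
by rewrite inE; case/orP: sq => /andP[-> _]; rewrite ?orbT.
Qed.

(** Cut and uncut relations of [P] are the unions of those of [S] and [Q].  Let
    the shared elements [T] consist of [a] elements in [D] and [b] outside.  The
    two unions overlap in at least [a + b] uncut relations (the reflexive ones)
    and in at most [a * b] cut ones, and [a * b <= a + b - 1] holds because
    [1 <= a + b <= 3]. *)
Lemma light_cut_glued : ids != [::] -> (#|Ext S| <= 3)%N -> light_cut D.
Proof.
move=> ids0 ext3; split.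
- move=> x y xD /(glued_le PSQ) [[s [s' [-> xE le]]]|[q [q' [-> xE le]]]];
    move: xD le; rewrite {}xE.
    by rewrite !fD => /(light_ideal lightS); apply.
  by rewrite !gD => /(light_ideal lightQ); apply.
- move=> p; case: (glued_cover PSQ p) => [[s ->] /f_minimal|[q ->] /g_minimal].
    by rewrite fD; apply: light_minimal.
  by rewrite gD; apply: light_minimal.
- move=> p; case: (glued_cover PSQ p) => [[s ->] /f_maximal|[q ->] /g_maximal].
    by rewrite fD; apply: light_maximal.
  by rewrite gD; apply: light_maximal.
have T0 : (0 < #|T|)%N.
  case: ids ids0 (glued_meet PSQ) => // -[s q] l _ meet.
  apply/card_gt0P; exists (f s).
  rewrite inE imset_f //=; have /eqP -> : f s == g q by rewrite meet inE eqxx.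
  exact: imset_f.
have uncutU : uncut_rel D = (F @: uncut_rel DS :|: G @: uncut_rel DQ)%SET.
  exact: (relE (fun a b => a == b)).
have cutU : cut_rel D = (F @: cut_rel DS :|: G @: cut_rel DQ)%SET.
  exact: (relE (fun a b => a && ~~ b)).
(* Each shared element contributes its reflexive relation. *)
have uncutI : (#|T| <= #|F @: uncut_rel DS :&: G @: uncut_rel DQ|%SET)%N.
  rewrite -(card_imset _ (f := fun p : P => (p, p))); last by move=> p q [].
  apply: subset_leq_card; apply/fintype.subsetP => _ /imsetP[p + ->].
  rewrite inE => /andP[/imsetP[s _ ps] /imsetP[q _ pq]]; rewrite inE.
  apply/andP; split.
    by apply/imsetP; exists (s, s); rewrite ?ps // inE /= lexx eqxx.
  by apply/imsetP; exists (q, q); rewrite ?pq // inE /= lexx eqxx.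
have cutI : (#|F @: cut_rel DS :&: G @: cut_rel DQ|%SET
             <= #|T :&: D|%SET * #|T :\: D|%SET)%N.
  rewrite -cardsX; apply: subset_leq_card; apply/fintype.subsetP => e.
  rewrite inE => /andP[/imsetP[[s s'] + ->] /imsetP[[q q'] _ [sq sq']]].
  rewrite !inE /= => /and3P[_ sD s'D].
  have -> : f s \in f @: finset.setT by exact: imset_f.
  have -> : f s' \in f @: finset.setT by exact: imset_f.
  have -> : f s \in g @: finset.setT by rewrite sq imset_f.
  have -> : f s' \in g @: finset.setT by rewrite sq' imset_f.
  by move: (fD s) (fD s'); rewrite !inE => -> ->; rewrite sD s'D.
have := cardsUI (F @: uncut_rel DS) (G @: uncut_rel DQ).
have := cardsUI (F @: cut_rel DS) (G @: cut_rel DQ).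
rewrite -uncutU -cutU !card_imset //.
have := light_card lightS; have := light_card lightQ.
move: T_card T0 ext3 uncutI cutI; rewrite -(cardsID D T).
move: #|T :&: D|%SET #|T :\: D|%SET => a b Text ab0 ext3 uncutI cutI.
have : (a * b <= (a + b).-1)%N.
  have : (a + b <= 3)%N by exact: leq_trans ext3.
  by case: a b {Text uncutI cutI} ab0 => [|[|[|[|a]]]] [|[|[|[|b]]]].
move: #|F @: cut_rel DS :&: _|%SET #|F @: uncut_rel DS :&: _|%SET cutI uncutI.
move=> ci ui cutI uncutI.
move: #|uncut_rel D| #|cut_rel D| #|uncut_rel DS| #|cut_rel DS|.
move: #|uncut_rel DQ| #|cut_rel DQ|.
by move: (a * b)%N cutI; lia.
Qed.
End Glue.

(** In a spanning tree on at least two vertices no vertex is isolated, hence no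
    vertex is at once a source and a sink.  An extremal element has edges in one
    direction only: minimal elements are sources and maximal ones are not. *)
Lemma toral_pair_light_cut (R : realType) (k : fieldType) (d : Order.disp_t)
    (S : finPOrderType d) (F : {set S * S}) :
  toral_pair R k F -> light_cut (sources F).
Proof.
move=> [_ F0 ext _ _ [FRel Fconn _] [_ idF inner0] _ _].
have F_lt p q : (p, q) \in F -> (p < q)%O.
  by move/(fintype.subsetP FRel); rewrite inE.
have F_cut e : e \in F -> e.1 \in sources F /\ e.2 \notin sources F.
  move: e => [p q] pq /=; split.
    have : p \notin inner_vertices F by rewrite inner0 inE.
    rewrite inE negb_and !negbK => /orP[|//].
    by rewrite inE => /forallP/(_ q); rewrite pq.
  by rewrite inE; apply/negP => /forallP/(_ p); rewrite pq.
have : (1 < #|Ext S|)%N by case: ext => ->.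
case/card_gt1P => x [y [_ _ xy]].
split=> //.
- move=> p /forallP pmin; rewrite inE; apply/forallP => q; apply/negP => /F_lt lt.
  by have := pmin q; rewrite (ltW lt) /= (lt_eqF lt).
- move=> p /forallP pmax; apply/negP; rewrite inE => /forallP psrc.
  have [q qp] : exists q, q != p.
    by case: (eqVneq x p) xy => [-> yp|xp _]; [exists y; rewrite eq_sym | exists x].
  have /connectP[[|r s] /= + qE] := Fconn p q; first by rewrite qE eqxx in qp.
  case/andP => + _; rewrite /Defs.adjacent (negPf (psrc r)) orbF => /F_lt lt.
  by have := pmax r; rewrite (ltW lt) /= (gt_eqF lt).
- exact: (card_uncut_le x idF F0).
Qed.

Lemma toral_light_cut (R : realType) (k : fieldType) (d : Order.disp_t)
    (P : finPOrderType d) :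
  toral R k P -> inhabited P /\ exists D : {set P}, light_cut D.
Proof.
elim=> {d P} [d S F SF|dQ Q dS S F dP P _ [[q] [DQ lightQ]] SF [ids [f [g [rl glue]]]]].
  split; last by exists (sources F); exact: toral_pair_light_cut SF.
  have : (0 < #|Ext S|)%N by case: (tp_P1 SF) => ->.
  by case/card_gt0P => p _.
split; first exact: (inhabits (g q)).
eexists; apply: (light_cut_glued glue (toral_pair_light_cut SF) lightQ).
  by case: rl.
by case: (tp_P1 SF) => ->.
Qed.

Theorem theorem10 (R : realType) (k : fieldType) (k_char0 : [pchar k] =i pred0)
    (d : Order.disp_t) (P : finPOrderType d)
    (P_frobenius : frobenius (gA_lie k P)) (P_toral : toral R k P) :
  binary_spectrum (gA_lie k P).
Proof.
have [[p] [D [idD _ _ leD]]] := toral_light_cut P_toral.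
exact: (cut_binary p k_char0 idD leD).
Qed.
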